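(* Let $p$, $q$, $r$ be distinct primes and let $\mathfrak{S}=\mathfrak{A}_p\mathfrak{A}_q\mathfrak{A}_r$. Let $n=p^{\alpha}q^{\beta}r^{\gamma}$ where $\alpha,\beta,\gamma\in\mathbb{N}$. Then the number $f_{\mathfrak{S}}(n)$ of groups of order $n$ in $\mathfrak{S}$, up to isomorphism, satisfies $$f_{\mathfrak{S}}(n) \leq p^{6\alpha^{2}} \,2^{\alpha - 1 + (23/6) \alpha \log(\alpha) + \alpha \log(6)}\, (6^{1/2})^{(\alpha + \gamma)\beta + (\alpha + \beta)\gamma +\alpha(\alpha-1)/2}\, n^{\beta + \gamma}.$$
   Context: $\log$ denotes the logarithm to base $2$, and the convention $0\in\mathbb{N}$ is used. For a prime $u$, $\mathfrak{A}_u$ is the variety of abelian groups of exponent dividing $u$. For distinct primes $u,v$, $\mathfrak{A}_u\mathfrak{A}_v$ is the variety of all groups $G$ having an abelian normal subgroup $N$ of exponent dividing $u$ such that $G/N$ is abelian of exponent dividing $v$. Likewise $\mathfrak{A}_p\mathfrak{A}_q\mathfrak{A}_r$ is the variety of all groups $G$ having an abelian normal subgroup $N$ of exponent dividing $p$ such that $G/N\in\mathfrak{A}_q\mathfrak{A}_r$.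
   Formalization: The case n = 1 (α = β = γ = 0) is excluded: there the trivial group gives f(1) = 1 while the right-hand side is 2^{-1} = 1/2 (reading 0·log 0 as 0), so the inequality as printed fails. *)

(* Defs.v *)
(* MathComp / MathComp-Analysis. *)
From mathcomp Require Import all_boot all_order all_algebra all_fingroup.
From mathcomp Require Import all_solvable.
From mathcomp Require Import reals exp.

Set Implicit Arguments.
Unset Strict Implicit.
Unset Printing Implicit Defensive.

Import Order.TTheory GRing.Theory Num.Theory.

Section Varieties.
Local Open Scope group_scope.

(* Only the finite members of a variety matter for counting groups of a given
   order, so a variety is represented by a predicate on finite groups. *)
Definition group_class := forall gT : finGroupType, {group gT} -> bool.

Definition isog_invariant (C : group_class) : Prop :=
  forall (aT rT : finGroupType) (G : {group aT}) (H : {group rT}),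
    G \isog H -> C aT G -> C rT H.

Definition var_abelian (u : nat) : group_class :=
  fun gT G => abelian G && (exponent G %| u)%N.

Definition var_prod (A B : group_class) : group_class :=
  fun gT G => [exists N : {group gT},
    [&& N <| G, A gT N & B (coset_of N) (G / N)%G]].

(* A group of order n acts on itself by translations, hence embeds in 'S_n;
   so the isomorphism classes of groups of order n correspond to the classes
   for [isog] of the subgroups of order n of 'S_n. The lemma [num_groupsP]
   certifies that this is the number of isomorphism classes, taken over all
   finite group types. *)
Definition num_groups (C : group_class) (n : nat) : nat :=
  #|equivalence_partition (fun G H : {group 'S_n} => G \isog H)
      [set G : {group 'S_n} | (#|G| == n) && C _ G]|.

Lemma var_abelian_isog u : isog_invariant (var_abelian u).
Proof.
move=> aT rT G H isoGH; rewrite /var_abelian.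
by rewrite (isog_abelian isoGH) (exponent_isog isoGH).
Qed.

Lemma var_prod_isog A B :
  isog_invariant A -> isog_invariant B -> isog_invariant (var_prod A B).
Proof.
move=> invA invB aT rT G H /isogP[f injf fG] /existsP[N /and3P[nsNG AN BGN]].
have sNG := normal_sub nsNG.
apply/existsP; exists (f @* N)%G; apply/and3P; split.
- by rewrite -fG /=; apply: morphim_normal.
- exact: invA (sub_isog sNG injf) AN.
- apply: invB BGN; apply/isogP; exists (quotm_morphism f nsNG).
    exact: injm_quotm.
  by rewrite morphim_quotm fG.
Qed.

Lemma sub_Sym_isog (gT : finGroupType) (G : {group gT}) :
  exists H : {group 'S_#|G|}, G \isog H.
Proof.
set T := subg_of G; have isoG : G \isog [set: T] := isog_subg G.
have -> : #|G| = #|T| by rewrite (card_isog isoG) cardsT.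
pose h (x : T) (i : 'I_#|T|) := enum_rank (enum_val i * x).
have inj_h x : injective (h x).
  by move=> i j /enum_rank_inj /mulIg /enum_val_inj.
pose f x := perm (@inj_h x).
have fM : {in [set: T] &, {morph f : x y / x * y}}.
  move=> x y _ _; apply/permP=> i.
  by rewrite permM !permE /h enum_rankK mulgA.
exists (Morphism fM @* setT)%G; apply: isog_trans isoG _; apply/isogP.
exists (Morphism fM) => //; apply/injmP=> x y _ _ /= /permP/(_ (enum_rank 1)).
by rewrite !permE /h enum_rankK => /enum_rank_inj; rewrite !mul1g.
Qed.

Lemma num_groupsP (C : group_class) (n : nat) : isog_invariant C ->
  exists R : {set {group 'S_n}},
    [/\ #|R| = num_groups C n,
        forall H, H \in R -> #|H| = n /\ C _ H,
        forall H K, H \in R -> K \in R -> H \isog K -> H = K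
      & forall (gT : finGroupType) (G : {group gT}),
          #|G| = n -> C gT G -> exists2 H, H \in R & G \isog H].
Proof.
move=> invC; rewrite /num_groups.
set D := [set G | _]; set r := (fun G H : {group 'S_n} => _).
have eqr : {in D & &, equivalence_rel r}.
  move=> G H K _ _ _; split; first exact: isog_refl.
  by move=> isoGH; apply: isog_transl.
have partD := equivalence_partitionP eqr.
have trR := transversalP partD; set P := equivalence_partition r D in partD trR *.
set R := transversal P D in trR *.
have sRD := fintype.subsetP (transversal_sub trR).
have RE := pblock_equivalence_partition eqr.
exists R; split.
- exact: card_transversal trR.
- by move=> H /sRD; rewrite inE => /andP[/eqP].
- move=> H K RH RK isoHK; apply: (pblock_inj trR) => //.
  apply/esym/same_pblock; first by case/and3P: partD.
  by rewrite RE ?sRD // /r isog_sym.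
move=> gT G oG CG; have := sub_Sym_isog G; rewrite oG => -[K0 isoGK].
have DK : K0 \in D by rewrite inE -(card_isog isoGK) oG eqxx (invC _ _ _ _ isoGK).
have PK : pblock P K0 \in P by rewrite pblock_mem // (cover_partition partD).
pose H := transversal_repr K0 R (pblock P K0).
have RH : H \in R := repr_mem_transversal trR K0 PK.
have : H \in pblock P K0 := repr_mem_pblock trR K0 PK.
by rewrite (RE K0 H DK (sRD _ RH)) => isoKH; exists H => //; apply: isog_trans isoGK isoKH.
Qed.

End Varieties.

Definition var_S (p q r : nat) : group_class :=
  var_prod (var_abelian p) (var_prod (var_abelian q) (var_abelian r)).

Lemma var_S_isog p q r : isog_invariant (var_S p q r).
Proof.
by apply: var_prod_isog; [|apply: var_prod_isog]; apply: var_abelian_isog.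
Qed.

(* As [ln 0 = 0], this gives 0 at 0, so that [0 * log2 0 = 0]. *)
Definition log2 (R : realType) (x : R) : R := (ln x / ln 2)%R.

(* Main.v *)
(* A group of order p^a m in A_p C, with C a class of p'-groups, splits as
   N ><| H with N elementary abelian of order p^a and H in C of order m. Hence it
   is determined by H and by the isomorphism class of N as an F_p[H]-module.
   These modules are semisimple. An irreducible one of dimension d is trivial on
   all u-elements of H with u a prime > p^d, since their orbits have size 1 or
   at least u. So the irreducible modules of dimension d factor through a
   quotient of H whose order has all its prime factors <= p^d, hence is at most
   p^(ds), where s is the number of prime factors of m with multiplicity. The
   number of irreducible modules of a group is at most its order; summing over
   the compositions of a leaves at most 2^(a-1) p^(as) modules of dimension a.
   Applying this first over A_r, where there is one group of each order r^c, and
   then over A_q A_r, gives at most 2^(b-1) q^(bc) 2^(a-1) p^(a(b+c)) groups. *)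
Require Import Defs.
From mathcomp Require Import all_boot all_order all_algebra all_fingroup.
From mathcomp Require Import all_solvable all_character.
From mathcomp Require Import reals exp ring.

Set Implicit Arguments.
Unset Strict Implicit.
Unset Printing Implicit Defensive.

Import Order.TTheory GRing.Theory Num.Theory.

Section Combinatorics.
Local Open Scope nat_scope.

Lemma leq_card_fibers (I T : finType) (D : {set I}) (E : {set T}) (c : I -> T)
    (k : nat) :
    {in D, forall i, c i \in E} ->
    {in E, forall t, #|[set i in D | c i == t]| <= k} ->
  #|D| <= #|E| * k.
Proof.
move=> DE le_k; rewrite -sum1_card (partition_big c (mem E)) //= -sum_nat_const.
apply: leq_sum => t Et; rewrite sum1_card; apply: leq_trans (le_k t Et).
by rewrite subset_leq_card //; apply/subsetP=> i; rewrite !inE.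
Qed.

Lemma sum_pred_exp2 (n : nat) : \sum_(e < n.+1) 2 ^ e.-1 = 2 ^ n.
Proof.
elim: n => [|n IHn]; first by rewrite big_ord1.
by rewrite big_ord_recr /= IHn addnn -mul2n expnS.
Qed.

Definition smooth_bound (s m : nat) : Prop :=
  forall B k, 0 < B -> k %| m -> (forall u, prime u -> u %| k -> u <= B) ->
  k <= B ^ s.

Lemma smooth_bound1 : smooth_bound 0 1.
Proof. by move=> B k _; rewrite dvdn1 => /eqP->. Qed.

Lemma smooth_boundM (u s m : nat) :
  prime u -> smooth_bound s m -> smooth_bound s.+1 (u * m).
Proof.
move=> u_pr bnd B k B_gt0 dv_k leB; have [/dvdnP[k' Dk]|u'k] := boolP (u %| k).
  rewrite expnS Dk mulnC leq_mul ?leB ?Dk ?dvdn_mull //.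
  apply: bnd => // [|v v_pr v_dv].
    by rewrite -(@dvdn_pmul2l u) ?prime_gt0 // mulnC -Dk.
  by apply: leB; rewrite // Dk dvdn_mulr.
have co_ku : coprime k u by rewrite coprime_sym prime_coprime.
by rewrite expnS -[k]mul1n leq_mul // bnd // -(Gauss_dvdr m co_ku).
Qed.

Lemma smooth_boundX (u e s m : nat) :
  prime u -> smooth_bound s m -> smooth_bound (e + s) (u ^ e * m).
Proof.
move=> u_pr bnd; elim: e => [|e IHe]; first by rewrite mul1n.
by rewrite addSn expnS -mulnA; apply: smooth_boundM.
Qed.

End Combinatorics.

Section Modules.
Local Open Scope ring_scope.
Local Open Scope group_scope.
Local Open Scope nat_scope.

Lemma card_irrType_leq (F : fieldType) (gT : finGroupType) (G : {group gT})
    (sG : irrType F G) : #|sG| <= #|G|.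
Proof.
have := mxdirectP (Socle_direct sG) => /=.
move=> defS; apply: leq_trans (rank_leq_row (Socle sG)).
rewrite [X in _ <= X]defS -sum1_card; apply: leq_sum => i _.
apply: leq_trans (mxrankS (component_mx_id (socle_simple i))).
by rewrite lt0n mxrank_eq0; case: (socle_simple i).
Qed.

Section CountModules.

Variables (p : nat) (gT : finGroupType) (G : {group gT}).
Local Notation F := 'F_p.
Local Notation reprG := (representation F G).

(* A u-group with u > |V| acts on V with only trivial orbits. *)
Lemma large_prime_rker (u n : nat) (rG : mx_representation F G n)
    (S : {group gT}) :
  S \subset G -> u.-group S -> prime u -> #|F| ^ n < u -> S \subset rker rG.
Proof.
move=> sSG uS u_pr; case: n rG => [|n] rG ltu.
  apply/subsetP=> x /(subsetP sSG) Gx; apply/rkerP.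
  by rewrite [LHS]flatmx0 [RHS]flatmx0.
rewrite -(astab_setT_repr rG).
have actS : [acts S, on [set: 'rV[F]_n.+1] | 'MR rG].
  apply/subsetP=> x /(subsetP sSG) Gx.
  by rewrite !inE Gx; apply/subsetP=> v _; rewrite !inE.
have := pgroup_fix_mod uS actS.
have cV : #|[set: 'rV[F]_n.+1]| = #|F| ^ n.+1 by rewrite cardsT card_mx mul1n.
rewrite setTI.
have le_fix : #|'Fix_('MR rG)(S)| <= #|[set: 'rV[F]_n.+1]|.
  by rewrite subset_leq_card ?subsetT.
rewrite !modn_small ?cV //; last by rewrite (leq_ltn_trans le_fix) ?cV.
rewrite -cV => /esym/eqP; rewrite eqn_leq => /andP[_ ge_fix].
have /eqP fixT : 'Fix_('MR rG)(S) == setT by rewrite eqEcard subsetT.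
by rewrite astabCin ?fixT.
Qed.

Lemma irr_classes_leq (I : finType) (rs : I -> reprG) (D : {set I}) (s d : nat) :
    [pchar F]^'.-group G -> smooth_bound s #|G| ->
    {in D, forall i, rdegree (rs i) = d /\ mx_irreducible (rs i)} ->
  exists (T : finType) (c : I -> T), #|T| <= (#|F| ^ d) ^ s
    /\ {in D &, forall i j, c i = c j -> mx_rsim (rs i) (rs j)}.
Proof.
move=> F'G bndG irrD.
pose K := (G :&: \bigcap_(i in D) rker (rs i))%G.
have sKG : K \subset G by apply: subsetIl.
have nKG : G \subset 'N(K).
  apply: normsI; first exact: normG.
  by apply: norms_bigcap; apply/bigcapsP=> i _; apply: rker_norm.
have kerK i : i \in D -> K \subset rker (rs i).
  by move=> Di; apply: subset_trans (subsetIr _ _) (bigcap_inf i Di).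
have F'GK : [pchar F]^'.-group (G / K) by apply: quotient_pgroup.
pose sGK : irrType F (G / K)%G := DecSocleType (regular_repr F (G / K)%G).
pose inflate (t : sGK) : mx_representation F G (irr_degree t) :=
  morphim_repr (irr_repr t) nKG.
have ex_c i : exists t, i \in D -> mx_rsim (rs i) (inflate t).
  have [Di | _] := boolP (i \in D); last by exists (principal_comp sGK).
  pose rQ := quo_repr (kerK i Di) nKG.
  have irrQ : mx_irreducible rQ by apply/quo_mx_irr; case: (irrD i Di).
  exists (irr_comp sGK rQ) => _.
  have [B eqn fB homB] := rsim_irr_comp_pchar sGK F'GK irrQ.
  exists B => // x Gx.
  by rewrite -(quo_repr_coset (kerK i Di) nKG Gx) homB ?mem_quotient.
have [c cP] := fin_all_exists ex_c.
exists sGK, c; split=> [|i j Di Dj eq_c]; last first.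
  by apply: mx_rsim_trans (cP i Di) _; rewrite eq_c; apply/mx_rsim_sym/cP.
apply: leq_trans (card_irrType_leq sGK) _; apply: bndG.
- by rewrite expn_gt0 (cardD1 0%R).
- exact: dvdn_quotient.
move=> u u_pr; apply: contraLR; rewrite -ltnNge => ltu.
have [S /and3P[sSG uS u'GS]] := Sylow_exists u G.
suffices sSK : S \subset K.
  by rewrite card_quotient // -p'natE // (pnat_dvd (indexgS G sSK)).
rewrite subsetI sSG; apply/bigcapsP=> i Di.
by apply: large_prime_rker u_pr _; rewrite // (proj1 (irrD i Di)).
Qed.

Lemma mx_decompose (r : reprG) :
    [pchar F]^'.-group G -> 0 < rdegree r ->
  exists r12 : reprG * reprG, [/\ mx_irreducible r12.1, 0 < rdegree r12.1,
    rdegree r12.1 + rdegree r12.2 = rdegree r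
    & forall r1 r2 : reprG, mx_rsim r12.1 r1 -> mx_rsim r12.2 r2 ->
        mx_rsim r (dadd_grepr r1 r2)].
Proof.
move=> F'G; case: r => n rG /= n_gt0.
have nz1 : (1%:M : 'M[F]_n)%R != 0%R by rewrite -mxrank_eq0 mxrank1 -lt0n.
have [U simU _] := dec_mxsimple_exists (mxmodule1 rG) nz1.
have [modU nzU _] := simU.
have [W modW defUW dxUW] := mx_Maschke_pchar rG F'G modU (submx1 U).
exists (Representation (submod_repr modU), Representation (submod_repr modW)).
split=> /=; first exact/submod_mx_irr.
- by rewrite lt0n mxrank_eq0.
- by rewrite -[RHS](mxrank1 F n) -defUW (mxdirectP dxUW).
move=> r1 r2 simU1 simW2.
apply: mx_rsim_trans (mx_rsim_sym (rsim_submod1 (mxmodule1 rG) _)) _ => //.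
exact: (@mx_rsim_dadd _ _ _ _ rG U W 1%:M r1 r2 modU modW (mxmodule1 rG)
  defUW dxUW simU1 simW2).
Qed.

Lemma card_modules_leq (I : finType) (rs : I -> reprG) (D : {set I}) (s n : nat) :
    [pchar F]^'.-group G -> smooth_bound s #|G| ->
    {in D, forall i, rdegree (rs i) = n} ->
    {in D &, forall i j, mx_rsim (rs i) (rs j) -> i = j} ->
  #|D| <= 2 ^ n.-1 * (#|F| ^ n) ^ s.
Proof.
move=> F'G bndG; have [m] := ubnP n; elim: m n rs D => // m IHm n rs D.
have F_gt0 : 0 < #|F| by rewrite (cardD1 0%R).
case: n => [_ deg0 inj_rs | n ltnm deg_n inj_rs].
  rewrite exp1n; apply/card_le1_eqP => i j Di Dj; apply: inj_rs => //.
  case: (rs i) (deg0 i Di) => ni ri /= ni0.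
  case: (rs j) (deg0 j Dj) => nj rj /= nj0.
  rewrite ni0 nj0 in ri rj *; exists 1%:M%R => // [|x _].
    by rewrite /row_free mxrank1.
  by rewrite [LHS]flatmx0 [RHS]flatmx0.
have ex_r i : exists r12 : reprG * reprG, i \in D ->
  [/\ mx_irreducible r12.1, 0 < rdegree r12.1,
    rdegree r12.1 + rdegree r12.2 = n.+1
    & forall r1 r2 : reprG, mx_rsim r12.1 r1 -> mx_rsim r12.2 r2 ->
        mx_rsim (rs i) (dadd_grepr r1 r2)].
  have [Di | _] := boolP (i \in D); last by exists (rs i, rs i).
  have [||r12 [? ? dr ?]] := @mx_decompose (rs i); rewrite ?deg_n //.
  by exists r12 => _; split; rewrite // dr deg_n.
have [r12 r12P] := fin_all_exists ex_r.
pose E (d : 'I_n.+2) := [set i in D | rdegree (r12 i).1 == d].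
have cardE d : #|E d| <= 2 ^ (n - d.-1).-1 * (#|F| ^ n.+1) ^ s * (0 < d).
  case: (posnP d) => [d0 | d_gt0].
    rewrite muln0 leqn0 cards_eq0; apply/eqP/setP=> i; rewrite !inE d0.
    by apply/andP=> [[Di]]; case: (r12P i Di) => _ /lt0n_neq0/negPf->.
  have [|T [c [leT cP]]] := @irr_classes_leq I (fun i => (r12 i).1) (E d) s d F'G bndG.
    by move=> i; rewrite inE => /andP[Di /eqP]; case: (r12P i Di).
  have le_dn : d <= n.+1 by rewrite -ltnS.
  have -> : 2 ^ (n - d.-1).-1 * (#|F| ^ n.+1) ^ s
      = (#|F| ^ d) ^ s * (2 ^ (n - d.-1).-1 * (#|F| ^ (n.+1 - d)) ^ s).
    by rewrite mulnCA -expnMn -expnD subnKC.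
  rewrite muln1; apply: leq_trans (leq_mul leT (leqnn _)); rewrite -cardsT.
  apply: (leq_card_fibers (c := c)) => [i _ | t _]; first by rewrite inE.
  have -> : n - d.-1 = n.+1 - d by case: (nat_of_ord d) d_gt0.
  apply: (IHm _ (fun i => (r12 i).2)).
  - rewrite -ltnS (leq_trans _ ltnm) // ltnS ltn_subLR //.
    by rewrite -[X in X < _]add0n ltn_add2r.
  - move=> i; rewrite !inE => /andP[/andP[Di /eqP <-] _].
    by case: (r12P i Di) => _ _ <- _; rewrite addKn.
  move=> i j; rewrite !inE => /andP[/andP[Di deg_i] /eqP ci].
  move=> /andP[/andP[Dj deg_j] /eqP cj] sim2.
  have sim1 : mx_rsim (r12 i).1 (r12 j).1 by apply: cP; rewrite ?inE ?Di ?Dj // ci.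
  have [_ _ _ simi] := r12P i Di; have [_ _ _ simj] := r12P j Dj.
  apply: inj_rs => //; apply: mx_rsim_trans (simi _ _ sim1 sim2) _.
  by apply/mx_rsim_sym/simj; apply: mx_rsim_refl.
have -> : #|D| = \sum_(d < n.+2) #|E d|.
  pose f i : 'I_n.+2 := inord (rdegree (r12 i).1).
  rewrite -sum1_card (partition_big f xpredT) //=; apply: eq_bigr => d _.
  rewrite -sum1_card; apply: eq_bigl => i; rewrite inE.
  case Di: (i \in D) => //=; rewrite -(inj_eq val_inj) /= inordK //.
  by case: (r12P i Di) => _ _ <- _; rewrite ltnS leq_addr.
apply: leq_trans (leq_sum _ (fun d _ => cardE d)) _.
rewrite big_ord_recl muln0 add0n /= -sum_pred_exp2 big_distrl /=.
rewrite (reindex_inj rev_ord_inj) /=; apply: leq_sum => e _.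
by rewrite muln1 /bump /= subSS subKn // -ltnS.
Qed.

End CountModules.

End Modules.

Section Extensions.
Local Open Scope ring_scope.
Local Open Scope group_scope.

(* The K-module r is N, with K acting by conjugation through an isomorphism of
   K with H. *)
Definition realizes (p : nat) (kT gT : finGroupType) (K : {group kT})
    (N H : {set gT}) (r : representation 'F_p K) : Prop :=
  exists (f : 'rV['F_p]_(rdegree r) -> gT) (g : {morphism K >-> gT}),
    [/\ {morph f : u v / (u + v)%R >-> u * v}, injective f, f @: setT = N
      & [/\ 'injm g, g @* K = H
        & forall v, {in K, forall k, f (v *m r k)%R = f v ^ g k}]].

Lemma abelem_realizes (p : nat) (kT gT : finGroupType) (K : {group kT})
    (N H : {group gT}) :
    prime p -> p.-abelem N -> H \subset 'N(N) -> K \isog H ->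
  exists r : representation 'F_p K,
    rdegree r = logn p #|N| /\ realizes N H r.
Proof.
move=> p_pr abN nNH /isogP[g injg gK].
have [N1 | ntN] := eqVneq (N : {set gT}) 1.
  exists (@grepr0 'F_p _ K); split; first by rewrite N1 cards1 logn1.
  exists (fun _ => 1), g; split=> // [u v | u v _ | | ].
  - by rewrite mulg1.
  - by rewrite [u]thinmx0 [v]thinmx0.
  - rewrite N1; apply/setP=> x; rewrite !inE; apply/imsetP/eqP=> [[v _ ->] // | ->].
    by exists 0%R; rewrite ?inE.
  by split=> // v k _; rewrite conj1g.
have nNg : g @* K \subset 'N(N) by rewrite gK.
exists (Representation (morphim_repr (abelem_repr abN ntN nNg) (subxx K))).
split; first exact: dim_abelemE.
exists (rVabelem abN ntN), g; split.
- exact: rVabelemD.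
- exact: rVabelem_inj.
- apply/setP=> x; apply/imsetP/idP=> [[v _ ->] | Nx]; first exact: mem_rVabelem.
  by exists (abelem_rV abN ntN x); rewrite ?inE ?abelem_rV_K.
split=> // v k Kk; exact: (rVabelemJ abN ntN nNg v (mem_morphim g Kk Kk)).
Qed.

Lemma realizes_isog (p : nat) (kT gT rT : finGroupType) (K : {group kT})
    (N1 H1 G1 : {group gT}) (N2 H2 G2 : {group rT})
    (r1 r2 : representation 'F_p K) :
    N1 ><| H1 = G1 -> N2 ><| H2 = G2 ->
    realizes N1 H1 r1 -> realizes N2 H2 r2 -> mx_rsim r1 r2 ->
  G1 \isog G2.
Proof.
case: r1 => d1 r1; case: r2 => d2 r2 /= defG1 defG2.
move=> [/= f1 [g1 [f1M f1I imf1 [g1I img1 f1J]]]].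
move=> [/= f2 [g2 [f2M f2I imf2 [g2I img2 f2J]]]] [B /= eqd].
rewrite -{d2}eqd in r2 f2 f2M f2I imf2 f2J B *.
rewrite row_free_unit => Bu homB.
pose e1 x := odflt 0%R [pick v | f1 v == x].
have e1K v : e1 (f1 v) = v.
  by rewrite /e1; case: pickP => [w /eqP/f1I // | /(_ v)/eqP].
have N1P x : x \in N1 -> {v | x = f1 v}.
  rewrite -imf1 => x1; exists (e1 x).
  by case/imsetP: x1 => v _ ->; rewrite e1K.
pose h x := f2 (e1 x *m B)%R.
have hM : {in N1 &, {morph h : x y / x * y}}.
  move=> _ _ /N1P[u ->] /N1P[v ->].
  by rewrite /h -f1M !e1K mulmxDl f2M.
pose hm := Morphism hM.
have hI : 'injm hm.
  apply/injmP=> _ _ /N1P[u ->] /N1P[v ->] /f2I; rewrite !e1K.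
  by move/(can_inj (mulmxK Bu))->.
have imh : hm @* N1 = N2.
  rewrite morphimEdom -imf2; apply/setP=> y; apply/imsetP/imsetP=> [] [x x1 ->{y}].
    by exists (e1 x *m B)%R.
  exists (f1 (x *m invmx B)%R); last by rewrite /= /h e1K mulmxKV.
  by rewrite -imf1 imset_f.
have H1P y : y \in H1 -> exists2 z, z \in K & y = g1 z.
  by rewrite -img1 => /morphimP[z _ Kz ->]; exists z.
pose k y := g2 (invm g1I y).
have kM : {in H1 &, {morph k : x y / x * y}}.
  move=> _ _ /H1P[x Kx ->] /H1P[y Ky ->].
  by rewrite /k -(morphM g1) // !invmE ?groupM // (morphM g2).
pose km := Morphism kM.
have kI : 'injm km.
  apply/injmP=> _ _ /H1P[x Kx ->] /H1P[y Ky ->] /=; rewrite /k !invmE //.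
  by move/(injmP g2I)=> ->.
have imk : km @* H1 = H2.
  rewrite morphimEdom -img2 morphimEdom; apply/setP=> y.
  apply/imsetP/imsetP=> [] [x x1 ->{y}].
    by have [z Kz ->] := H1P x x1; exists z; rewrite //= /k invmE.
  exists (g1 x); last by rewrite /= /k invmE.
  by rewrite -img1 mem_morphim.
have actP : {in N1 & H1, morph_act 'J 'J hm km}.
  move=> _ _ /N1P[v ->] /H1P[z Kz ->] /=.
  by rewrite -f1J // /h /k !e1K invmE // -mulmxA homB // mulmxA f2J.
apply/isogP; exists (sdprodm_morphism defG1 actP).
  by rewrite injm_sdprodm hI kI imh imk /=; case/sdprodP: defG2 => _ _ _ ->.
by rewrite im_sdprodm imh imk; case/sdprodP: defG2.
Qed.

Lemma coprime_extension_split (C : group_class) (p a m : nat)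
    (gT : finGroupType) (G : {group gT}) :
    prime p -> isog_invariant C ->
    (forall (rT : finGroupType) (H : {group rT}), C rT H -> p^'.-group H) ->
    ~~ (p %| m)%N -> #|G| = (p ^ a * m)%N ->
    var_prod (var_abelian p) C G ->
  exists N H : {group gT},
    [/\ p.-abelem N, #|N| = (p ^ a)%N, N ><| H = G, #|H| = m & C gT H].
Proof.
move=> p_pr invC p'C p'm oG /existsP[N /and3P[nsNG abN CGN]].
rewrite -[var_abelian p N](abelemE N p_pr) in abN.
have p'GN := p'C _ _ CGN; have pN := abelem_pgroup abN.
have m_gt0 : (0 < m)%N by rewrite lt0n; apply: contraNneq p'm => ->.
have p'm_nat : p^'.-nat m by rewrite p'natE.
have oN : #|N| = (p ^ a)%N.
  have hallN : p.-Sylow(G) N.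
    by rewrite /pHall normal_sub // pN -card_quotient ?normal_norm.
  rewrite (card_Hall hallN) oG partnM ?m_gt0 ?expn_gt0 ?prime_gt0 //.
  by rewrite part_pnat_id ?pnatX ?(pnat_id p_pr) // (part_p'nat p'm_nat) muln1.
have oGN : #|G / N| = m.
  rewrite card_quotient ?normal_norm // -divgS ?normal_sub // oG oN.
  by rewrite mulKn // expn_gt0 prime_gt0.
have /splitsP[H /complP[tiNH defG]] : [splits G, over N].
  apply: SchurZassenhaus_split => //; rewrite /Hall normal_sub //=.
  by rewrite -card_quotient ?normal_norm // oGN oN coprimeXl // prime_coprime.
have nNH : H \subset 'N(N).
  by apply: subset_trans (normal_norm nsNG); rewrite -defG mulG_subr.
have sdG : N ><| H = G by rewrite sdprodE.
have isoH := sdprod_isog sdG.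
exists N, H; split=> //; first by rewrite (card_isog isoH).
by apply: invC CGN; rewrite isog_sym.
Qed.

Lemma num_groups_extension (C : group_class) (p a m s : nat) :
    prime p -> isog_invariant C ->
    (forall (rT : finGroupType) (H : {group rT}), C rT H -> p^'.-group H) ->
    ~~ (p %| m)%N -> smooth_bound s m ->
  (num_groups (var_prod (var_abelian p) C) (p ^ a * m)
    <= num_groups C m * (2 ^ a.-1 * (p ^ a) ^ s))%N.
Proof.
move=> p_pr invC p'C p'm bnd_m.
have [R1 [<- R1_C R1_inj _]] := num_groupsP (p ^ a * m)
  (var_prod_isog (@var_abelian_isog p) invC).
have [R2 [<- R2_C _ R2_P]] := num_groupsP m invC.
have ex_c G : exists K, G \in R1 -> K \in R2 /\
  exists N H : {group _},
    [/\ p.-abelem N, #|N| = (p ^ a)%N, N ><| H = G & K \isog H].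
  have [RG | _] := boolP (G \in R1); last by exists 1%G.
  have [oG CG] := R1_C G RG.
  have [N [H [abN oN sdG oH CH]]] := coprime_extension_split p_pr invC p'C p'm oG CG.
  have [K RK isoHK] := R2_P _ H oH CH.
  by exists K => _; split=> //; exists N, H; rewrite isog_sym.
have [c cP] := fin_all_exists ex_c.
apply: (leq_card_fibers (c := c)) => [G RG | K RK]; first by case: (cP G RG).
have [oK CK] := R2_C K RK.
pose good (G : {group 'S_(p ^ a * m)}) (r : representation 'F_p K) :=
  rdegree r = a /\ exists N H : {group _}, N ><| H = G /\ realizes N H r.
have ex_r G : exists r, G \in [set G in R1 | c G == K] -> good G r.
  rewrite inE; have [RG | _] := boolP (G \in R1); last by exists (@grepr0 'F_p _ K).
  have [cG | _] := eqVneq (c G) K; last by exists (@grepr0 'F_p _ K).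
  have [_ [N [H [abN oN sdG isoKH]]]] := cP G RG.
  have [_ _ nNH _] := sdprodP sdG.
  rewrite cG in isoKH.
  have [r [deg_r rP]] := abelem_realizes p_pr abN nNH isoKH.
  by exists r => _; split; [rewrite deg_r oN pfactorK | exists N, H].
have [r rP] := fin_all_exists ex_r.
have := card_modules_leq (rs := r) (D := [set G in R1 | c G == K]) (s := s) (n := a).
rewrite (card_Fp p_pr); apply.
- by rewrite (eq_p'group _ (pcharf_eq (pchar_Fp p_pr))) p'C.
- by rewrite oK.
- by move=> G /rP[].
move=> G1 G2 R_G1 R_G2 sim12; have [_ [N1 [H1 [sd1 real1]]]] := rP G1 R_G1.
have [_ [N2 [H2 [sd2 real2]]]] := rP G2 R_G2.
apply: R1_inj (realizes_isog sd1 sd2 real1 real2 sim12).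
  by move: R_G1; rewrite inE => /andP[].
by move: R_G2; rewrite inE => /andP[].
Qed.

End Extensions.

Section IteratedExtensions.
Local Open Scope ring_scope.
Local Open Scope group_scope.
Local Open Scope nat_scope.

Lemma num_groups_abelian (r c : nat) :
  prime r -> num_groups (var_abelian r) (r ^ c) <= 1.
Proof.
move=> r_pr; have [R [<- R_C R_inj _]] := num_groupsP (r ^ c) (@var_abelian_isog r).
apply/card_le1_eqP => G H RG RH; apply: R_inj => //.
have [oG abG] := R_C G RG; have [oH abH] := R_C H RH.
have abelG : r.-abelem G by rewrite (abelemE G r_pr).
by rewrite isog_sym (isog_abelem_card _ abelG) (abelemE H r_pr) oG oH eqxx andbT.
Qed.

Lemma var_abelian_pgroup (u : nat) (gT : finGroupType) (G : {group gT}) :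
  prime u -> var_abelian u G -> u.-group G.
Proof.
by move=> u_pr; rewrite /var_abelian -(abelemE G u_pr) => /abelem_pgroup.
Qed.

Lemma var_prod_abelian_pi (pi : nat_pred) (u : nat) (C : group_class) :
    prime u -> u \in pi ->
    (forall (rT : finGroupType) (H : {group rT}), C rT H -> pi.-group H) ->
  forall (gT : finGroupType) (G : {group gT}),
    var_prod (var_abelian u) C G -> pi.-group G.
Proof.
move=> u_pr pi_u piC gT G /existsP[N /and3P[nsNG abN CGN]].
have [sNG nNG] := andP nsNG; have uN := var_abelian_pgroup u_pr abN.
rewrite /pgroup -(Lagrange sNG) pnatM -card_quotient // [X in _ && X]piC // andbT.
by apply: sub_in_pnat uN => v _ /eqnP->.
Qed.

Lemma num_groups_var_S (p q r a b c : nat) :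
    prime p -> prime q -> prime r -> p != q -> p != r -> q != r ->
  num_groups (var_S p q r) (p ^ a * (q ^ b * r ^ c))
    <= 2 ^ b.-1 * (q ^ b) ^ c * (2 ^ a.-1 * (p ^ a) ^ (b + c)).
Proof.
move=> p_pr q_pr r_pr p_q p_r q_r.
have r_pi (pi : nat_pred) : r \in pi -> forall (rT : finGroupType) (H : {group rT}),
    var_abelian r H -> pi.-group H.
  by move=> pi_r rT H /(var_abelian_pgroup r_pr); apply: sub_in_pnat => u _ /eqP->.
have bnd_r : smooth_bound c (r ^ c).
  by rewrite -[r ^ c]muln1 -[X in smooth_bound X]addn0; apply: smooth_boundX smooth_bound1.
have q'rc : ~~ (q %| r ^ c).
  by rewrite Euclid_dvdX // dvdn_prime2 // (negPf q_r).
have p'qr : ~~ (p %| q ^ b * r ^ c).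
  rewrite Euclid_dvdM // !Euclid_dvdX // !dvdn_prime2 //.
  by rewrite (negPf p_q) (negPf p_r).
have bnd_qr := smooth_boundX (e := b) q_pr bnd_r.
apply: leq_trans (num_groups_extension a p_pr _ _ p'qr bnd_qr) _.
- by apply: var_prod_isog; apply: var_abelian_isog.
- apply: var_prod_abelian_pi => //; first by rewrite inE /= inE eq_sym.
  by apply: r_pi; rewrite inE /= inE eq_sym.
apply: leq_mul (leqnn _).
apply: leq_trans (num_groups_extension b q_pr _ _ q'rc bnd_r) _.
- exact: var_abelian_isog.
- by apply: r_pi; rewrite inE /= inE eq_sym.
by rewrite -[X in _ <= X]mul1n leq_mul // num_groups_abelian.
Qed.

Lemma combined_bound_leq (p q r a b c : nat) :
    prime p -> prime q -> prime r -> 1 < p ^ a * q ^ b * r ^ c ->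
  2 * (2 ^ b.-1 * (q ^ b) ^ c * (2 ^ a.-1 * (p ^ a) ^ (b + c)))
    <= p ^ (6 * a ^ 2) * 2 ^ a * (p ^ a * q ^ b * r ^ c) ^ (b + c).
Proof.
move=> p_pr q_pr r_pr n_gt1.
have key : 2 * (2 ^ b.-1 * 2 ^ a.-1)
    <= p ^ (6 * a ^ 2) * 2 ^ a * ((q ^ b) ^ b * (r ^ c) ^ (b + c)).
  have X_gt0 u e : prime u -> 0 < u ^ e by move=> /prime_gt0 u0; rewrite expn_gt0 u0.
  have XX_gt0 u e f : prime u -> 0 < (u ^ e) ^ f by rewrite -expnM; apply: X_gt0.
  have le_b : 2 ^ b <= (q ^ b) ^ b.
    rewrite -expnM; apply: (@leq_trans (2 ^ (b * b))).
      by rewrite leq_exp2l // -{1}[b]muln1; case: (b) => // k; rewrite leq_mul.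
    by case: (b * b) => // k; rewrite leq_exp2r ?prime_gt1.
  case: a n_gt1 => [|a] n_gt1; last first.
    rewrite mulnCA -expnS -[leqLHS]mul1n -mulnA leq_mul ?X_gt0 //= mulnC.
    rewrite leq_mul // -[leqLHS]muln1 leq_mul ?XX_gt0 //.
    by apply: leq_trans le_b; rewrite leq_exp2l ?leq_pred.
  rewrite !expn0 !mul1n !muln1 in n_gt1 *.
  case: b n_gt1 le_b => [|b] n_gt1 le_b.
    rewrite !expn0 !mul1n in n_gt1 *; rewrite (leq_trans n_gt1) //.
    case: c n_gt1 => // c _; rewrite add0n [leqRHS]expnS.
    by rewrite leq_pmulr ?XX_gt0.
  by rewrite -expnS -[leqLHS]muln1 leq_mul ?XX_gt0.
rewrite [X in _ <= X](_ : _ = p ^ (6 * a ^ 2) * 2 ^ a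
  * ((q ^ b) ^ b * (r ^ c) ^ (b + c)) * ((q ^ b) ^ c * (p ^ a) ^ (b + c))); last first.
  rewrite !expnMn [(q ^ b) ^ (b + c)]expnD; ring.
apply: leq_trans (leq_mul key (leqnn _)).
apply: eq_leq; ring.
Qed.

End IteratedExtensions.

Local Open Scope ring_scope.

Lemma log2_nat_ge0 (R : realType) (k : nat) : 0 <= log2 (k%:R : R).
Proof.
rewrite /log2; case: k => [|k]; first by rewrite ln0 ?mul0r.
by rewrite divr_ge0 ?ln_ge0 ?ler1n.
Qed.

Theorem theoremA (R : realType) (p q r : nat)
  (p_prime : prime p) (q_prime : prime q) (r_prime : prime r)
  (p_neq_q : p <> q) (p_neq_r : p <> r) (q_neq_r : q <> r)
  (alpha beta gamma n : nat)
  (n_def : n = (p ^ alpha * q ^ beta * r ^ gamma)%N)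
  (n_gt1 : (1 < n)%N) :
  (num_groups (var_S p q r) n)%:R <=
    p%:R ^+ (6 * alpha ^ 2)
    * 2 `^ (alpha%:R - 1 + 23 / 6 * alpha%:R * log2 alpha%:R
            + alpha%:R * log2 6)
    * (6 `^ (1 / 2)) `^ ((alpha%:R + gamma%:R) * beta%:R
                         + (alpha%:R + beta%:R) * gamma%:R
                         + alpha%:R * (alpha%:R - 1) / 2)
    * n%:R ^+ (beta + gamma) :> R.
Proof.
have le_count := num_groups_var_S alpha beta gamma p_prime q_prime r_prime
  (introN eqP p_neq_q) (introN eqP p_neq_r) (introN eqP q_neq_r).
rewrite mulnA -n_def in le_count; rewrite n_def in n_gt1.
have le_bound := combined_bound_leq p_prime q_prime r_prime n_gt1.
rewrite -n_def in le_bound.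
have le2 : (num_groups (var_S p q r) n)%:R
    <= p%:R ^+ (6 * alpha ^ 2) * 2 ^+ alpha / 2 * n%:R ^+ (beta + gamma) :> R.
  rewrite mulrAC ler_pdivlMr ?ltr0n // mulrC -!natrX -!natrM ler_nat.
  by apply: leq_trans le_bound; rewrite leq_mul2l.
apply: le_trans le2 _.
have ge0 (k : nat) : 0 <= k%:R :> R by apply: ler0n.
rewrite ler_wpM2r ?exprn_ge0 // -mulrA.
have -> : 2 ^+ alpha / 2 = 2 `^ (alpha%:R - 1) :> R.
  by rewrite powRD ?pnatr_eq0 ?implybT // powR_mulrn // powR_inv1.
rewrite -[leLHS]mulr1 ler_pM ?mulr_ge0 ?exprn_ge0 ?powR_ge0 //.
  rewrite ler_wpM2l ?exprn_ge0 // ler_powR ?ler1n // -addrA lerDl.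
  have := (log2_nat_ge0 R alpha, log2_nat_ge0 R 6).
  move: (log2 alpha%:R) (log2 6) => l1 l6 [l1_ge0 l6_ge0].
  by rewrite addr_ge0 ?mulr_ge0 ?invr_ge0.
have le1 : 1 <= 6 `^ (1 / 2) :> R.
  by rewrite -[leLHS](powRr0 6) ler_powR ?ler1n ?divr_ge0.
have binom_ge0 : 0 <= alpha%:R * (alpha%:R - 1) / 2 :> R.
  rewrite divr_ge0 //; case: (alpha) => [|a]; first by rewrite mul0r.
  by rewrite -[a.+1%:R]natr1 addrK mulr_ge0 ?addr_ge0.
rewrite -[leLHS](powRr0 (6 `^ (1 / 2))) ler_powR //.
by rewrite addr_ge0 // addr_ge0 // mulr_ge0 // addr_ge0.
Qed.
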